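(* Let $ABC$ be a nondegenerate triangle with $a=|BC|$, $b=|CA|$, $c=|AB|$, area $S$, circumcenter $O$ and circumradius $R$. Let $x,y,z$ be real numbers with $a^2x+b^2y+c^2z\neq0$, and let $P=(a^2x+b^2y+c^2z)^{-1}[a^2x,\ b^2y,\ c^2z]$. Then $$\left(xa^2+yb^2+zc^2\right)^2-16S^2(yz+zx+xy)=\frac{1}{R^2}\left(xa^2+yb^2+zc^2\right)^2|PO|^2\ \ge\ 0 .$$
   Context: Barycentric coordinates are taken with respect to triangle $ABC$ and normalized: $[u,v,w]$ with $u+v+w=1$ denotes the point $uA+vB+wC$ (affine combination of the vertices). *)

(* Defs.v *)
From mathcomp Require Import all_boot all_order all_algebra.
From mathcomp Require Import reals.
Set Implicit Arguments.
Unset Strict Implicit.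
Unset Printing Implicit Defensive.
Import Order.TTheory GRing.Theory Num.Theory.
Local Open Scope ring_scope.

(* Points of the Euclidean plane are row vectors in 'rV[R]_2. *)

(* Euclidean distance; the norm that MathComp-Analysis puts on matrices is the
   sup norm, hence the explicit square root. *)
Definition edist (R : realType) (U V : 'rV[R]_2) : R :=
  Num.sqrt (\sum_(i < 2) (U 0 i - V 0 i) ^+ 2).

Definition edges (R : realType) (A B C : 'rV[R]_2) : 'M[R]_(1 + 1, 2) :=
  col_mx (B - A) (C - A).

(* Linear independence of B - A and C - A, that is, A, B, C are not collinear. *)
Definition nondegenerate_triangle (R : realType) (A B C : 'rV[R]_2) : bool :=
  row_free (edges A B C).

(* Half the area of the parallelogram spanned by the two edge vectors. *)
Definition triangle_area (R : realType) (A B C : 'rV[R]_2) : R :=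
  `|\det (edges A B C)| / 2.

Definition is_circumcircle (R : realType) (A B C O : 'rV[R]_2) (r : R) : Prop :=
  [/\ edist O A = r, edist O B = r & edist O C = r].

(* The point [u, v, w]; meaningful when u + v + w = 1. *)
Definition bary (R : realType) (A B C : 'rV[R]_2) (u v w : R) : 'rV[R]_2 :=
  u *: A + v *: B + w *: C.

(* Main.v *)
Require Import Defs.
From mathcomp Require Import all_boot all_order all_algebra.
From mathcomp Require Import reals.
From mathcomp Require Import ring.
Import Order.TTheory GRing.Theory Num.Theory.
Local Open Scope ring_scope.

(** Placing the circumcenter at the origin, the vertices become vectors of
    squared norm [r ^+ 2].  Expanding the squared norm of their combination with
    weights [u = a^2 x], [v = b^2 y], [w = c^2 z] and polarizing gives
    [k^2 |PO|^2 = r^2 k^2 - (u v c^2 + v w a^2 + w u b^2)], whose last bracket is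
    [a^2 b^2 c^2 (y z + z x + x y)]; conclude by [a b c = 4 S r]. *)

Lemma edist_sqr (R : realType) (U V : 'rV[R]_2) :
  edist U V ^+ 2 = (U 0 0 - V 0 0) ^+ 2 + (U 0 1 - V 0 1) ^+ 2.
Proof.
rewrite sqr_sqrtr; last by apply: sumr_ge0 => i _; apply: sqr_ge0.
by rewrite big_ord_recl big_ord1; congr ((_ - _) ^+ 2 + (U 0 _ - V 0 _) ^+ 2);
  apply: val_inj.
Qed.

Lemma det_mx22 (R : comNzRingType) (M : 'M[R]_2) :
  \det M = M 0 0 * M 1 1 - M 0 1 * M 1 0.
Proof.
rewrite (expand_det_row _ 0) big_ord_recl big_ord1 /cofactor !det_mx11 !mxE.
rewrite /= expr0 expr1 mul1r mulN1r mulrN.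
by congr (M _ _ * M _ _ - M _ _ * M _ _); apply: val_inj.
Qed.

Lemma det_edges (R : realType) (A B C : 'rV[R]_2) :
  \det (edges A B C) =
  (B 0 0 - A 0 0) * (C 0 1 - A 0 1) - (B 0 1 - A 0 1) * (C 0 0 - A 0 0).
Proof.
have e0 i : edges A B C 0 i = B 0 i - A 0 i.
  by rewrite mxE; case: splitP => // k _; rewrite ord1 !mxE.
have e1 i : edges A B C 1 i = C 0 i - A 0 i.
  by rewrite mxE; case: splitP => k //; rewrite ord1 !mxE.
by rewrite (det_mx22 _ (edges A B C)) !e0 !e1.
Qed.

Lemma triangle_area_sqr (R : realType) (A B C : 'rV[R]_2) :
  4 * triangle_area A B C ^+ 2 = \det (edges A B C) ^+ 2.
Proof. by rewrite expr_div_n real_normK ?num_real //; field. Qed.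

(** If [r] were zero, [B] and [C] would both coincide with [O]; the two edge vectors would be equal
    and their determinant zero. *)
Lemma circumradius_neq0 (R : realType) (A B C O : 'rV[R]_2) (r : R) :
  nondegenerate_triangle A B C -> is_circumcircle A B C O r -> r != 0.
Proof.
rewrite /nondegenerate_triangle row_free_unit unitmxE unitfE det_edges.
move=> ndeg [_ hB hC]; apply: contra_neq ndeg => r0.
have eqO V : edist O V = r -> forall j, V 0 j = O 0 j.
  move=> hV; have /eqP := edist_sqr _ O V.
  rewrite hV r0 expr0n /= eq_sym paddr_eq0 ?sqr_ge0 // !sqrf_eq0 !subr_eq0.
  move=> /andP[/eqP e0 /eqP e1] j.
  have : (j == 0) || (j == 1) by case: j => -[|[|]].
  by case/orP => /eqP ->.
by rewrite !(eqO B) // !(eqO C) //; ring.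
Qed.

(** This is [a b c = 4 S r] squared, which trades the absolute value in the area for a squared
    determinant and leaves a polynomial identity. *)
Lemma prod_sides_sqr (R : realType) (A B C O : 'rV[R]_2) (r : R) :
  is_circumcircle A B C O r ->
  edist B C ^+ 2 * edist C A ^+ 2 * edist A B ^+ 2 =
  16 * triangle_area A B C ^+ 2 * r ^+ 2.
Proof.
move=> [hA hB hC].
have -> : 16 * triangle_area A B C ^+ 2 = 4 * (4 * triangle_area A B C ^+ 2).
  by ring.
rewrite triangle_area_sqr det_edges.
have := edist_sqr _ O A; have := edist_sqr _ O B; have := edist_sqr _ O C.
rewrite hA hB hC !edist_sqr.
set p1 := A 0 0; set p2 := A 0 1; set q1 := B 0 0; set q2 := B 0 1.
set s1 := C 0 0; set s2 := C 0 1; set o1 := O 0 0; set o2 := O 0 1.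
(* The identity with the circumcenter at the origin and [t] the squared radius. Each hypothesis has
   a monomial on the left, so [ring] can use it as a rewrite rule. *)
have gram (a1 a2 b1 b2 c1 c2 t : R) : a1 ^+ 2 = t - a2 ^+ 2 ->
    b1 ^+ 2 = t - b2 ^+ 2 -> c1 ^+ 2 = t - c2 ^+ 2 ->
    ((b1 - c1) ^+ 2 + (b2 - c2) ^+ 2) * ((c1 - a1) ^+ 2 + (c2 - a2) ^+ 2)
      * ((a1 - b1) ^+ 2 + (a2 - b2) ^+ 2) =
    4 * ((b1 - a1) * (c2 - a2) - (b2 - a2) * (c1 - a1)) ^+ 2 * t.
  by move=> ha hb hc; ring: ha hb hc.
move=> eC eB eA.
have := gram (o1 - p1) (o2 - p2) (o1 - q1) (o2 - q2) (o1 - s1) (o2 - s2)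
  (r ^+ 2).
rewrite {1}eA {1}eB {1}eC !addrK => /(_ erefl erefl erefl) e.
(* Only differences of vertices occur, so the translation by [O] cancels on both sides. *)
by apply: etrans (etrans _ e) _; ring.
Qed.

Lemma bary_edist_sqr (R : realType) (A B C O : 'rV[R]_2) (r u v w : R) :
  is_circumcircle A B C O r -> u + v + w = 1 ->
  edist (bary A B C u v w) O ^+ 2 =
  r ^+ 2 - (v * w * edist B C ^+ 2 + w * u * edist C A ^+ 2
            + u * v * edist A B ^+ 2).
Proof.
move=> [hA hB hC] uvw1.
have eA := edist_sqr _ O A; have eB := edist_sqr _ O B; have eC := edist_sqr _ O C.
rewrite hA in eA; rewrite hB in eB; rewrite hC in eC.
(* Splitting [r ^+ 2] by weights lets each copy become the squared distance from [O] to its own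
   vertex; what remains is Leibniz's formula for weights of sum 1. *)
have -> : r ^+ 2 = (u + v + w) * (u * r ^+ 2 + v * r ^+ 2 + w * r ^+ 2).
  by rewrite -!mulrDl uvw1 !mul1r.
rewrite {1}eA {1}eB eC !edist_sqr !mxE.
have -> : w = 1 - u - v by rewrite -uvw1; ring.
by ring.
Qed.

Theorem mainTheorem10 (R : realType) (A B C O : 'rV[R]_2) (r x y z : R)
    (hABC : nondegenerate_triangle A B C) (hO : is_circumcircle A B C O r) :
  let a := edist B C in
  let b := edist C A in
  let c := edist A B in
  let S := triangle_area A B C in
  let k := a ^+ 2 * x + b ^+ 2 * y + c ^+ 2 * z in
  k != 0 ->
  let P := bary A B C (k^-1 * (a ^+ 2 * x)) (k^-1 * (b ^+ 2 * y))
                      (k^-1 * (c ^+ 2 * z)) in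
  (x * a ^+ 2 + y * b ^+ 2 + z * c ^+ 2) ^+ 2
    - 16 * S ^+ 2 * (y * z + z * x + x * y)
  = 1 / r ^+ 2 * (x * a ^+ 2 + y * b ^+ 2 + z * c ^+ 2) ^+ 2 * edist P O ^+ 2
  /\
  0 <= 1 / r ^+ 2 * (x * a ^+ 2 + y * b ^+ 2 + z * c ^+ 2) ^+ 2
         * edist P O ^+ 2.
Proof.
move=> a b c S k k0 P.
split; last by rewrite div1r -exprVn -!exprMn sqr_ge0.
have r0 := circumradius_neq0 _ _ _ _ _ _ hABC hO.
have sum1 : k^-1 * (a ^+ 2 * x) + k^-1 * (b ^+ 2 * y) + k^-1 * (c ^+ 2 * z) = 1.
  by rewrite -!mulrDr mulVf.
rewrite (bary_edist_sqr _ _ _ _ _ _ _ _ _ hO sum1) -/a -/b -/c.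
have -> : x * a ^+ 2 + y * b ^+ 2 + z * c ^+ 2 = k by rewrite /k; ring.
have -> : 16 * S ^+ 2 = a ^+ 2 * b ^+ 2 * c ^+ 2 / r ^+ 2.
  by rewrite (prod_sides_sqr _ _ _ _ _ _ hO) mulfK // expf_neq0.
(* The identity holds for any nonzero [k]: the two factors [k^-1] in each product of weights cancel
   [k ^+ 2]. *)
by clearbody k; field; rewrite r0 k0.
Qed.
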